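(* Let $\mathcal{D}_F=D_F+\mathcal{D}_{\min}$, with $D_F\subset\mathcal{E}$, be the domain of the Friedrichs extension of $A_c$. Then $\mathcal{P}_{D_F^\perp}\cap H^{-1/2}_{\mathcal{D}_F^\dag}=0$.
   Context: Setting: $H$ is a separable (complex) Hilbert space with inner product $(\cdot,\cdot)$, and $A_c:\mathcal{D}_c\subset H\to H$ is a densely defined unbounded symmetric operator bounded from below (there is $m\in\mathbb{R}$ with $(A_cu,u)\ge m\|u\|^2$ for $u\in\mathcal{D}_c$). $A:\mathcal{D}_{\max}\subset H\to H$ is the adjoint of $A_c$ (an extension of $A_c$). $\mathcal{D}_{\max}$ is a Hilbert space with inner product $(u,v)_A=(Au,Av)+(u,v)$. $\mathcal{D}_{\min}$ is the domain of the closure of $A_c$ (the closure of $\mathcal{D}_c$ in $\mathcal{D}_{\max}$). It is assumed that the inclusion $\mathcal{D}_{\max}\hookrightarrow H$ is compact and that $\mathcal{D}_{\min}$ has finite positive codimension in $\mathcal{D}_{\max}$. For a subspace $\mathcal{D}$ with $\mathcal{D}_{\min}\subset\mathcal{D}\subset\mathcal{D}_{\max}$, $A_{\mathcal{D}}$ denotes $A$ with domain $\mathcal{D}$. $\mathcal{E}$ is the orthogonal complement of $\mathcal{D}_{\min}$ in $\mathcal{D}_{\max}$ with respect to $(\cdot,\cdot)_A$; its dimension is $2d$ where $d=-\operatorname{ind}A_{\mathcal{D}_{\min}}>0$. $\mathfrak{SA}$ is the set of ($d$-dimensional) subspaces $D\subset\mathcal{E}$ such that $A$ with domain $D+\mathcal{D}_{\min}$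 is selfadjoint. For $D\subset\mathcal{E}$, $D^\perp$ is the $(\cdot,\cdot)_A$-orthogonal complement of $D$ in $\mathcal{E}$. Sobolev-like spaces: let $\mathcal{D}=D+\mathcal{D}_{\min}$ with $D\in\mathfrak{SA}$. The spectrum of $A_{\mathcal{D}}$ is discrete; let $\Pi_{\mathcal{D},\lambda}$ be the orthogonal projection in $H$ on $\ker(A_{\mathcal{D}}-\lambda)$. For $s\ge0$, $H^s_{\mathcal{D}}=\{u\in H:\sum_{\lambda\in\operatorname{spec}(A_{\mathcal{D}})}(1+|\lambda|)^{2s}\|\Pi_{\mathcal{D},\lambda}u\|^2<\infty\}$, a Hilbert space with inner product $(u,v)_s=\sum_\lambda(1+|\lambda|)^{2s}(\Pi_{\mathcal{D},\lambda}u,\Pi_{\mathcal{D},\lambda}v)$; $H^1_{\mathcal{D}}=\mathcal{D}$ with equivalent norms. $H^{-s}_{\mathcal{D}^\dag}$ is the dual of $H^s_{\mathcal{D}}$ (continuous linear functionals). For $0\le s<s'$ the space $H^{-s}_{\mathcal{D}^\dag}$ is identified with a subspace of $H^{-s'}_{\mathcal{D}^\dag}$ via the (injective) dual of the dense inclusion $H^{s'}_{\mathcal{D}}\hookrightarrow H^s_{\mathcal{D}}$. For $u\in D^\perp$, $\delta_u\in H^{-1}_{\mathcal{D}^\dag}$ is the functional $\langle\delta_u,\psi\rangle=(A\psi,u)-(\psi,Au)$, $\psi\in H^1_{\mathcal{D}}=\mathcal{D}$, and $\mathcal{P}_{D^\perp}=\{\delta_u:u\in D^\perp\}$. *)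

(* Defs.v *)
From HB Require Import structures.
From mathcomp Require Import all_boot all_order all_algebra.
From mathcomp Require Import complex sesquilinear.
From mathcomp Require Import all_classical all_reals all_analysis.

Set Implicit Arguments.
Unset Strict Implicit.
Unset Printing Implicit Defensive.

Import Order.TTheory GRing.Theory Num.Theory.
Import numFieldNormedType.Exports.

Local Open Scope classical_set_scope.
Local Open Scope complex_scope.
Local Open Scope ring_scope.

(* An operator with domain [opdom]; the values of [opfun] outside [opdom] are
   junk and no definition below depends on them. *)
Record operator (H : Type) := Operator { opdom : set H; opfun :> H -> H }.

Definition linear_subspace (K : numFieldType) (H : normedModType K)
    (V : set H) : Prop :=
  V 0 /\ forall (a : K) (u v : H), V u -> V v -> V (a *: u + v).

Definition linear_operator (K : numFieldType) (H : normedModType K)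
    (T : operator H) : Prop :=
  linear_subspace (opdom T) /\
  forall (a : K) (u v : H), opdom T u -> opdom T v ->
    T (a *: u + v) = a *: T u + T v.

Definition op_restrict (H : Type) (T : operator H) (D : set H) : operator H :=
  Operator D T.

Definition separable (X : topologicalType) : Prop :=
  exists2 S : set X, countable S & dense S.

Definition has_codim (K : numFieldType) (H : normedModType K)
    (V W : set H) (n : nat) : Prop :=
  V `<=` W /\
  exists2 e : 'I_n -> H, forall i, W (e i) &
    forall u, W u -> exists! a : 'rV[K]_n, V (u - \sum_i a ord0 i *: e i).

Definition set_sum (H : zmodType) (V W : set H) : set H :=
  [set x + y | x in V & y in W].

Definition rnorm (R : realType) (V : normedZmodType R[i]) (x : V) : R :=
  complex.Re `|x|.

(* Inner products are linear in the first argument. *)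
Notation inner_product H := {dot H for @Num.conj _}.

Section Defs.
Context (R : realType) (H : completeNormedModType R[i]) (ip : inner_product H).
Implicit Types (T : operator H) (D V : set H) (u v : H).

Definition symmetric_operator T : Prop :=
  forall u v, opdom T u -> opdom T v -> ip (T u) v = ip u (T v).

Definition bounded_below T : Prop :=
  exists m : R, forall u, opdom T u -> m%:C * `|u| ^+ 2 <= ip (T u) u.

(* The vector w below is unique as soon as [opdom T] is dense. *)
Definition adjoint T : operator H :=
  let adj v := [set w | forall u, opdom T u -> ip (T u) v = ip u w] in
  Operator [set v | adj v !=set0] (fun v => xget 0 (adj v)).

Definition Dmax T : set H := opdom (adjoint T).

Definition graph_ip T u v : R[i] :=
  ip (adjoint T u) (adjoint T v) + ip u v.

Definition Dmin T : set H :=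
  [set u | Dmax T u /\ forall eps : R[i], 0 < eps ->
     exists2 v, opdom T v & graph_ip T (u - v) (u - v) < eps].

Definition compact_inclusion T : Prop :=
  precompact [set u | Dmax T u /\ graph_ip T u u <= 1].

Definition Dmin_compl T : set H :=
  [set u | Dmax T u /\ forall v, Dmin T v -> graph_ip T u v = 0].

Definition graph_perp T D : set H :=
  [set u | Dmin_compl T u /\ forall v, D v -> graph_ip T u v = 0].

(* The domain of the closure of the quadratic form u |-> (T u, u): limits in H
   of sequences that are Cauchy for the form. *)
Definition form_dom T : set H :=
  [set u | exists2 u_ : nat -> H, (forall n, opdom T (u_ n)) &
     u_ n @[n --> \oo] --> u /\
     forall eps : R[i], 0 < eps -> exists N : nat, forall n k : nat,
       (N <= n)%N -> (N <= k)%N ->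
       `|ip (T (u_ n - u_ k)) (u_ n - u_ k)| < eps].

(* Freudenthal's description of the Friedrichs extension: the restriction of
   the adjoint to the vectors of its domain that lie in the form domain. *)
Definition friedrichs T : operator H :=
  op_restrict (adjoint T) (Dmax T `&` form_dom T).

Definition op_ker T (l : R[i]) : set H :=
  [set u | opdom T u /\ T u = l *: u].

Definition resolvent_set T : set R[i] :=
  [set l | exists2 B : {linear H -> H}, continuous B &
     (forall v, opdom T (B v) /\ T (B v) - l *: B v = v) /\
     (forall u, opdom T u -> B (T u - l *: u) = u)].

Definition spectrum T : set R[i] := ~` resolvent_set T.

Definition orth_proj V u : H :=
  xget 0 [set p | V p /\ forall v, V v -> ip (u - p) v = 0].

Definition sobolev_sqnorm T (s : R) u : \bar R :=
  (\esum_(l in spectrum T)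
     ((1 + rnorm l) `^ (2 * s) * rnorm (orth_proj (op_ker T l) u) ^+ 2)%:E)%E.

Definition sobolev T (s : R) : set H :=
  [set u | (sobolev_sqnorm T s u < +oo)%E].

Definition sobolev_norm T (s : R) u : R :=
  Num.sqrt (fine (sobolev_sqnorm T s u)).

(* Functionals on a subspace V of H are represented by functions on H that
   vanish outside V, so that equality of functionals is Leibniz equality. *)
Definition functional_on V (f : H -> R[i]) : H -> R[i] :=
  patch (fun=> 0) V f.

Definition sobolev_dual T (s : R) : set (H -> R[i]) :=
  [set f | [/\ f = functional_on (sobolev T s) f,
     forall (a : R[i]) u v, sobolev T s u -> sobolev T s v ->
       f (a *: u + v) = a * f u + f v &
     forall u, sobolev T s u -> forall eps : R, 0 < eps ->
       exists2 del : R, 0 < del & forall v, sobolev T s v ->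
         sobolev_norm T s (v - u) < del -> rnorm (f v - f u) < eps]].

(* The dual of order s regarded inside the dual of order s', for s < s', via
   restriction of functionals. *)
Definition sobolev_dual_in T (s s' : R) : set (H -> R[i]) :=
  [set functional_on (sobolev T s') f | f in sobolev_dual T s].

(* The functional is written on the domain D, which is the space of order 1
   attached to the restriction of the adjoint to D. *)
Definition delta T D u : H -> R[i] :=
  functional_on D (fun psi => ip (adjoint T psi) u - ip psi (adjoint T u)).

Definition delta_space T D V : set (H -> R[i]) :=
  [set delta T D u | u in V].

End Defs.

(* Main.v *)
(** A vector [x] of the Friedrichs domain is by construction the limit of vectors
[u_ n] of [opdom Ac] that form a Cauchy sequence for the quadratic form of [Ac].
Since the form is bounded below by [m], the shifted form [(A x - m x, y)] extends
to a nonnegative Hermitian form on the Friedrichs domain and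
[(A w - m w, w) -> 0] for [w = u_ n - x]. Bessel's inequality for this form, applied
to the eigenvectors [Pi_l w], bounds the squared norm of order 1/2 of [w] by
[(A w - m w, w) + (1 + |m|) |w|^2], so [u_ n -> x] in the space of order 1/2. Now
[delta_u] vanishes on [opdom Ac] by definition of the adjoint; when it is
continuous in the norm of order 1/2, it therefore vanishes at [x] too. *)

Require Import Defs.
From HB Require Import structures.
From mathcomp Require Import all_boot all_order all_algebra.
From mathcomp Require Import complex sesquilinear.
From mathcomp Require Import all_classical all_reals all_analysis.
From mathcomp Require Import ring finmap.

Set Implicit Arguments.
Unset Strict Implicit.
Unset Printing Implicit Defensive.

Import Order.TTheory GRing.Theory Num.Theory.
Import numFieldNormedType.Exports.

Local Open Scope classical_set_scope.
Local Open Scope complex_scope.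
Local Open Scope ring_scope.

(** * Subspaces, and Bessel's inequality for a semidefinite form *)

Lemma linear_subspaceB (K : numFieldType) (H : normedModType K) (V : set H)
    (x y : H) : linear_subspace V -> V x -> V y -> V (x - y).
Proof. by move=> [_ VP] Vx Vy; rewrite addrC -scaleN1r; apply: VP. Qed.

(** Removing the [p i] from [w] one at a time lowers [B w w] by exactly [B (p i) (p i)] each time,
    and what is left is nonnegative. The [p i] stand for projections of [w] rather than unit
    vectors, so nothing is divided by and [B] may degenerate. This covers both the inner product and
    the shifted form. *)
Lemma bessel_inequality (K : numDomainType) (U : zmodType) (I : eqType)
    (F : set U) (B : U -> U -> K) (p : I -> U) (s : seq I) (w : U) :
  (forall x y, F x -> F y -> F (x - y)) ->
  (forall x y z, F x -> F y -> F z -> B (x - y) z = B x z - B y z) ->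
  (forall x y z, F x -> F y -> F z -> B z (x - y) = B z x - B z y) ->
  (forall x, F x -> 0 <= B x x) ->
  uniq s -> (forall i, F (p i)) ->
  (forall i j, i != j -> B (p i) (p j) = 0) ->
  F w -> (forall i, B w (p i) = B (p i) (p i)) ->
  (forall i, B (p i) w = B (p i) (p i)) ->
  \sum_(i <- s) B (p i) (p i) <= B w w.
Proof.
move=> FB Bl Br Bge0 us Fp orth Fw wp pw.
set q := foldr (fun i x => x - p i) w.
(* Invariant: an index not yet processed pairs with the remainder exactly as it does with [w]. *)
suff [Fq qp pq qq] : [/\ F (q s),
    forall i, i \notin s -> B (q s) (p i) = B (p i) (p i),
    forall i, i \notin s -> B (p i) (q s) = B (p i) (p i) &
    B (q s) (q s) = B w w - \sum_(i <- s) B (p i) (p i)].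
  by rewrite -subr_ge0 -qq Bge0.
elim: s us => [_|i s IHs /= /andP[si us]].
  by split=> //; rewrite big_nil subr0.
have [Fq qp pq qq] := IHs us.
have Fqi : F (q s - p i) by exact: FB.
split=> // [j|j|].
- rewrite inE negb_or => /andP[ji js].
  by rewrite Bl// qp// (orth i j) ?subr0// eq_sym.
- rewrite inE negb_or => /andP[ji js].
  by rewrite Br// pq// (orth j i) ?subr0.
- by rewrite Br// !Bl// qp// pq// subrr subr0 qq big_cons opprD addrCA addrC.
Qed.

(** * Elementary inner product estimates *)

Section InnerProduct.
Context (R : realType) (H : normedModType R[i]) (ip : inner_product H).
Hypothesis ip_norm : forall u : H, ip u u = `|u| ^+ 2.

Lemma ip_conj u v : ip u v = (ip v u)^*.
Proof. by rewrite hermC mul1r. Qed.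

Lemma ipZr a u v : ip u (a *: v) = a^* * ip u v.
Proof. exact: linearZr_LR. Qed.

Lemma ipZl a u v : ip (a *: u) v = a * ip u v.
Proof. exact: linearZl_LR. Qed.

(** Expands the square of [u - a *: v] at the minimising coefficient [a]. *)
Lemma cauchy_schwarz u v : `|ip u v| <= `|u| * `|v|.
Proof.
have [->|v0] := eqVneq v 0; first by rewrite linear0r !normr0 mulr0.
have v_gt0 : 0 < ip v v by rewrite dnorm_gt0.
set a := ip u v / ip v v.
have aE : ip u (a *: v) = `|ip u v| ^+ 2 / ip v v.
  by rewrite ipZr rmorphM/= fmorphV/= -(ip_conj v v) mulrAC normCKC.
have aa : `|a| ^+ 2 * ip v v = `|ip u v| ^+ 2 / ip v v.
  rewrite normrM normfV (gtr0_norm v_gt0) exprMn -mulrA; congr (_ * _).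
  by rewrite expr2 -mulrA mulVf ?mulr1// gt_eqF.
have := dnorm_ge0 ip (u - a *: v); rewrite dnormB dnormZ aE aa.
rewrite (geC0_conj (divr_ge0 (exprn_ge0 2 (normr_ge0 _)) (ltW v_gt0))).
rewrite opprD addrA addrK subr_ge0 ler_pdivrMr//.
by rewrite !ip_norm -exprMn ler_sqr// nnegrE ?mulr_ge0.
Qed.

(** If [z] were nonzero, a vector [u] of [C] closer to [z] than [|z|] would give
    [|z|^2 = (z - u, z) < |z|^2]. *)
Lemma dense_orth_eq0 (C : set H) (z : H) :
  dense C -> (forall u, C u -> ip u z = 0) -> z = 0.
Proof.
move=> dC Cz; apply/eqP; case: eqP => // /eqP z0.
have zp : 0 < `|z| by rewrite normr_gt0.
have [|u [/= zu Cu]] := dC (ball z `|z|) _ (ball_open _ _).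
  by exists z; apply: ballxx.
have : ip z z = ip (z - u) z by rewrite linearBl/= (Cz u)// subr0.
rewrite ip_norm => e; have := cauchy_schwarz (z - u) z.
rewrite -e normrX normr_id expr2 ler_pM2r// => /le_lt_trans h.
by move: zu; rewrite -ball_normE/= => /h; rewrite ltxx.
Qed.

Lemma norm_ip_le_lim (x_ : nat -> H) (x y : H) (N : nat) (e : R[i]) :
  x_ n @[n --> \oo] --> x ->
  (forall n, (N <= n)%N -> `|ip (x_ n) y| <= e) -> `|ip x y| <= e.
Proof.
move=> xx le_e; apply/ler_addgt0Pr => d d0.
(* With this radius the error [|x - x_ n| * |y|] is at most [d]; the [+ 1] covers [y = 0]. *)
have d1 : 0 < d / (`|y| + 1) by rewrite divr_gt0// ltr_wpDl.
have [M _ HM] := (cvgrPdist_lt _ _).1 xx _ d1.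
rewrite -[x](subrK (x_ (maxn N M))) linearDl addrC.
apply: (le_trans (ler_normD _ _)); apply: lerD; first exact/le_e/leq_maxl.
apply: (le_trans (cauchy_schwarz _ _)).
have /ltW h := HM (maxn N M) (leq_maxr _ _).
apply: (le_trans (ler_wpM2r _ h)) => //.
by rewrite mulrAC ler_pdivrMr ?ltr_wpDl// ler_pM2l// lerDl.
Qed.

End InnerProduct.

(** For nonzero [z], the unit [c = - z^* / |z|] makes the bracket equal to [- 2 |z|]. *)
Lemma norm_le_rotation (C : numClosedFieldType) (s z : C) :
  (forall c : C, `|c| = 1 -> 0 <= s + (c * z + (c * z)^*)) -> `|z| *+ 2 <= s.
Proof.
have [->|z0] := eqVneq z 0 => h.
  by have := h 1 (normr1 _); rewrite mulr0 conjC0 !addr0 normr0 mul0rn.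
have nz0 : `|z| != 0 by rewrite normr_eq0.
have := h (- (z^* / `|z|)).
rewrite normrN normrM normfV normr_id norm_conjC divff// => /(_ erefl).
have -> : - (z^* / `|z|) * z = - `|z|.
  by rewrite mulNr mulrAC -normCKC expr2 mulfK.
by rewrite rmorphN/= conj_normC -opprD subr_ge0 mulr2n.
Qed.

(** * Closure of a nonnegative form inside the domain [V] of [S] *)

Section FormClosure.
Context (R : realType) (H : normedModType R[i]) (ip : inner_product H).
Hypothesis ip_norm : forall u : H, ip u u = `|u| ^+ 2.
Variables (C V : set H) (S : H -> H).
Hypothesis C_subspace : linear_subspace C.
Hypothesis V_subspace : linear_subspace V.
Hypothesis CV : C `<=` V.
Hypothesis S_linear : forall (a : R[i]) x y, V x -> V y ->
  S (a *: x + y) = a *: S x + S y.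
Hypothesis S_adjoint : forall x y, C x -> V y -> ip (S x) y = ip x (S y).
Hypothesis S_ge0 : forall x, C x -> 0 <= ip (S x) x.

(** The Cauchy condition carries no modulus because the form is nonnegative on [C]. *)
Definition form_approx (u_ : nat -> H) (x : H) : Prop :=
  [/\ forall n, C (u_ n), u_ n @[n --> \oo] --> x &
      forall eps : R[i], 0 < eps -> exists N : nat, forall n k : nat,
        (N <= n)%N -> (N <= k)%N ->
        ip (S (u_ n - u_ k)) (u_ n - u_ k) < eps].

(** Limits are kept only when they lie in [V], so the extended form is simply [ip (S x) y] and does
    not have to be constructed as a limit. *)
Definition form_closure : set H := [set x | V x /\ exists u_, form_approx u_ x].

Local Notation F := form_closure.

Let CB x y : C x -> C y -> C (x - y).
Proof. exact: linear_subspaceB. Qed.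

Let VB x y : V x -> V y -> V (x - y).
Proof. exact: linear_subspaceB. Qed.

Let SB x y : V x -> V y -> S (x - y) = S x - S y.
Proof.
by move=> Vx Vy; rewrite addrC -scaleN1r S_linear// scaleN1r addrC.
Qed.

(** A division-free Cauchy-Schwarz inequality: expand the form at [c *: x + y] with [|c| = 1], then
    take the best [c]. *)
Lemma form_norm_le x y : C x -> C y ->
  `|ip (S x) y| *+ 2 <= ip (S x) x + ip (S y) y.
Proof.
move=> Cx Cy; have Vx := CV Cx; have Vy := CV Cy.
apply: norm_le_rotation => c c1.
have := S_ge0 (C_subspace.2 c x y Cx Cy).
rewrite S_linear// linearDl !linearDr/= !ipZl !ipZr.
rewrite (S_adjoint Cy Vx) (ip_conj ip y) rmorphM/= mulrA.
rewrite -normCK c1 expr1n mul1r -!addrA.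
by congr (_ <= _ + _); rewrite addrCA [RHS]addrC -!addrA addrCA.
Qed.

Lemma form_norm_small x y (e : R[i]) : C x -> C y ->
  ip (S x) x < e -> ip (S y) y < e -> `|ip (S x) y| <= e.
Proof.
move=> Cx Cy xe ye.
rewrite -(@ler_pMn2r _ 2)// (le_trans (form_norm_le Cx Cy))// mulr2n.
by rewrite lerD// ltW.
Qed.

(** Write [y - v_ n] and then [x - u_ n] as limits of differences in [C]. Each limit needs only
    convergence in [H], since [S] is first moved onto the argument that stays fixed; the Cauchy
    conditions bound what remains. *)
Lemma form_approx_error (u_ v_ : nat -> H) x y (e : R[i]) :
  V x -> V y -> form_approx u_ x -> form_approx v_ y -> 0 < e ->
  exists N : nat, forall n, (N <= n)%N ->
    `|ip (S (x - u_ n)) (y - v_ n)| <= e.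
Proof.
move=> Vx Vy [Cu ux uC] [Cv vy vC] e0.
have [N HN] := uC _ e0; have [M HM] := vC _ e0.
exists (maxn N M) => n; rewrite geq_max => /andP[Nn Mn].
have ux' : u_ k - u_ n @[k --> \oo] --> x - u_ n.
  by apply: cvgB => //; exact: cvg_cst.
have vy' : v_ k - v_ n @[k --> \oo] --> y - v_ n.
  by apply: cvgB => //; exact: cvg_cst.
have Vu k : V (u_ k) := CV (Cu k).
rewrite ip_conj norm_conjC.
apply: (@norm_ip_le_lim _ _ _ ip_norm _ _ _ M _ vy') => k Mk.
have Cvk : C (v_ k - v_ n) by exact: CB.
rewrite -S_adjoint//; last exact: VB.
rewrite ip_conj norm_conjC.
apply: (@norm_ip_le_lim _ _ _ ip_norm _ _ _ N _ ux') => l Nl.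
have Cul : C (u_ l - u_ n) by exact: CB.
rewrite -S_adjoint//; last exact: CV.
by apply: form_norm_small => //; [exact: HN|exact: HM].
Qed.

Lemma form_closure_sym x y : F x -> F y -> ip (S x) y = ip x (S y).
Proof.
move=> [Vx [u_ ux]] [Vy [v_ vy]]; apply/eqP; rewrite -subr_eq0 -normr_le0.
apply/ler_addgt0Pr => e e0; rewrite add0r.
have e2 : 0 < e / 2 by rewrite divr_gt0.
have [N HN] := form_approx_error Vx Vy ux vy e2.
have [M HM] := form_approx_error Vy Vx vy ux e2.
pose n := maxn N M.
have [Cu _ _] := ux; have [Cv _ _] := vy.
have Vu := CV (Cu n); have Vv := CV (Cv n).
(* The symmetry defect does not change when vectors of [C] are subtracted, because [S_adjoint]
   cancels every other term. *)
have -> : ip (S x) y - ip x (S y) =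
    ip (S (x - u_ n)) (y - v_ n) - ip (x - u_ n) (S (y - v_ n)).
  rewrite !SB// !linearBl !linearBr/= (S_adjoint (Cu n) Vy).
  rewrite (S_adjoint (Cu n) Vv) [ip (S x) (v_ n)]ip_conj.
  rewrite [ip x (S (v_ n))]ip_conj.
  rewrite (S_adjoint (Cv n) Vx).
  by ring.
apply: (le_trans (ler_normB _ _)); rewrite [leRHS]splitr lerD//.
  exact/HN/leq_maxl.
by rewrite ip_conj norm_conjC; exact/HM/leq_maxr.
Qed.

(** The parallelogram identity with the nonnegative value at [x - y] dropped. *)
Lemma form_parallelogram x y : C x -> C y ->
  ip (S (x + y)) (x + y) <= (ip (S x) x + ip (S y) y) *+ 2.
Proof.
move=> Cx Cy; have Vx := CV Cx; have Vy := CV Cy.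
have SD : S (x + y) = S x + S y by rewrite -[x]scale1r S_linear// !scale1r.
have := S_ge0 (CB Cx Cy); rewrite -(lerD2l (ip (S (x + y)) (x + y))) addr0.
congr (_ <= _); rewrite SD SB// !linearBl !linearBr/= !linearDl !linearDr/=.
by ring.
Qed.

Lemma form_closure_subspace : linear_subspace F.
Proof.
split.
  split; first exact: V_subspace.1.
  exists (fun=> 0); split=> [_||eps eps0]; first exact: C_subspace.1.
    exact: cvg_cst.
  by exists 0%N => n k _ _; rewrite subrr linear0r.
move=> a x y [Vx [u_ [Cu ux uC]]] [Vy [v_ [Cv vy vC]]].
split; first exact: V_subspace.2.
exists (fun n => a *: u_ n + v_ n); split=> [n||eps eps0].
- exact: C_subspace.2.
- by apply: cvgD => //; apply: cvgZr.
have a1 : 0 < `|a| ^+ 2 + 1 by rewrite ltr_wpDl// exprn_ge0.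
(* Scaling by [a] costs a factor [|a|^2] and the parallelogram bound doubles the sum, hence the
   quarters; the [+ 1] covers [a = 0]. *)
have [|N HN] := uC (eps / 4 / (`|a| ^+ 2 + 1)); first by rewrite !divr_gt0.
have [|M HM] := vC (eps / 4); first by rewrite divr_gt0.
exists (maxn N M) => n k; rewrite !geq_max => /andP[Nn Mn] /andP[Nk Mk].
rewrite opprD addrACA -scalerBr.
have Cd : C (u_ n - u_ k) by exact: CB.
have Cad : C (a *: (u_ n - u_ k)).
  by rewrite -[_ *: _]addr0; apply: C_subspace.2 => //; exact: C_subspace.1.
apply: (le_lt_trans (form_parallelogram Cad (CB (Cv n) (Cv k)))).
have -> : S (a *: (u_ n - u_ k)) = a *: S (u_ n - u_ k).
  have S0 : S 0 = 0 by rewrite -(subrr 0) SB ?subrr//; exact: V_subspace.1.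
  rewrite -[a *: _]addr0 S_linear ?S0 ?addr0//; first exact: CV.
  exact: V_subspace.1.
rewrite ipZl ipZr mulrA -normCK.
have -> : eps = (eps / 4 + eps / 4) *+ 2 by rewrite -mulr_natr; field.
rewrite ltrMn2r//= ltr_leD//; last exact/ltW/HM.
have := HN n k Nn Nk; rewrite ltr_pdivlMr// => /(le_lt_trans _); apply.
by rewrite mulrC ler_wpM2l ?lerDl// S_ge0.
Qed.

Lemma sub_form_closure : C `<=` F.
Proof.
move=> u Cu; split; first exact: CV.
exists (fun=> u); split=> // [|eps eps0]; first exact: cvg_cst.
exists 0%N => n k _ _.
by rewrite subrr linear0r.
Qed.

Lemma form_closure_dense x (d e : R[i]) : F x -> 0 < d -> 0 < e ->
  exists2 u, C u & `|x - u| < d /\ `|ip (S (x - u)) (x - u)| <= e.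
Proof.
move=> [Vx [u_ ux]] d0 e0; have [Cu ux' _] := ux.
have [N HN] := form_approx_error Vx Vx ux ux e0.
have [M _ HM] := (cvgrPdist_lt _ _).1 ux' _ d0.
exists (u_ (maxn N M)) => //; split; first exact/HM/leq_maxr.
exact/HN/leq_maxl.
Qed.

(** The value at [x] differs from the nonnegative value at a nearby [u] in [C] by [t + t^* - E],
    which is small when [u] is close to [x] both in [H] and in the form. *)
Lemma form_closure_ge0 x : F x -> 0 <= ip (S x) x.
Proof.
move=> Fx; apply/ler_addgt0Pr => e e0.
(* Chosen so that [2 |S x| d + d = e], where [d] bounds both [|x - u|] and [|E|]. *)
have k0 : 0 < `|S x| *+ 2 + 1 by rewrite ltr_wpDl// mulrn_wge0.
have d0 : 0 < e / (`|S x| *+ 2 + 1) by rewrite divr_gt0.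
have [u Cu [xu Exu]] := form_closure_dense Fx d0 d0.
have Fu := sub_form_closure Cu.
have Fw : F (x - u) by exact: linear_subspaceB form_closure_subspace Fx Fu.
set t := ip (S x) (x - u); set E := ip (S (x - u)) (x - u) in Exu.
have EE : E^* = E by rewrite -ip_conj -form_closure_sym.
have -> : ip (S x) x = ip (S u) u + (t + t^* - E).
  have -> : t^* = ip (S (x - u)) x by rewrite form_closure_sym// -ip_conj.
  rewrite /t /E SB; [|by case: Fx|by case: Fu].
  by rewrite !linearBl/= !linearBr/=; ring.
rewrite -addrA addr_ge0 ?S_ge0//.
(* Realness turns the bound on the modulus into a lower bound; [E] is real by symmetry of the
   extended form. *)
have rE : t + t^* - E \is Num.real.
  by rewrite CrealE rmorphB rmorphD/= conjCK EE [_ + t]addrC.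
have : `|t + t^* - E| <= e.
  apply: (le_trans (ler_normB _ _)).
  apply: (le_trans (lerD (ler_normD _ _) Exu)); rewrite norm_conjC.
  have te : `|t| <= `|S x| * (e / (`|S x| *+ 2 + 1)).
    apply: (le_trans (cauchy_schwarz ip_norm _ _)).
    by rewrite ler_wpM2l// ltW.
  apply: (le_trans (lerD (lerD te te) (lexx _))).
  rewrite -mulrDl -mulr2n -{2}[e / _]mul1r -mulrDl mulrC divfK//.
by rewrite real_ler_norml// => /andP[+ _]; rewrite -subr_ge0 opprK.
Qed.

End FormClosure.

(** * Bounds on the norms of order 1/2 and 1 by sums over eigenprojections *)

Lemma rnormE (R : realType) (V : normedZmodType R[i]) (x : V) :
  (rnorm x)%:C = `|x|.
Proof. by rewrite RRe_real. Qed.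

Lemma rnorm_ge0 (R : realType) (V : normedZmodType R[i]) (x : V) :
  0 <= rnorm x.
Proof. by rewrite -lecR rnormE (rmorph0 (real_complex R)). Qed.

Section SobolevBounds.
Context (R : realType) (H : completeNormedModType R[i]) (ip : inner_product H).
Hypothesis ip_norm : forall u : H, ip u u = `|u| ^+ 2.

(** The sum over the spectrum is a supremum of finite sums, so it suffices to bound sums over
    arbitrary duplicate-free lists of complex numbers. *)
Lemma sobolev_sqnorm_le (T : operator H) (s : R) (w : H) (X : R[i]) :
  (forall r : seq R[i], uniq r ->
    \sum_(l <- r) (((1 + rnorm l) `^ (2 * s))%:C *
                   `|orth_proj ip (op_ker T l) w| ^+ 2) <= X) ->
  (sobolev_sqnorm ip T s w <= (complex.Re X)%:E)%E.
Proof.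
move=> le_X; apply: ge_ereal_sup => _ [A [finA _] <-].
rewrite fsbig_finite//= sumEFin lee_fin.
have := le_X _ (fset_uniq (fset_set A)).
under eq_bigr do rewrite -rnormE -rmorphXn -rmorphM/=.
by rewrite -rmorph_sum/= lecE => /andP[].
Qed.

Variables (F D : set H) (A : H -> H) (m : R).
Hypothesis F_subspace : linear_subspace F.
Hypothesis A_linear : forall (a : R[i]) x y, F x -> F y ->
  A (a *: x + y) = a *: A x + A y.
Hypothesis A_sym : forall x y, F x -> F y -> ip (A x) y = ip x (A y).
Hypothesis A_ge : forall x, F x -> m%:C * `|x| ^+ 2 <= ip (A x) x.
Hypothesis DF : D `<=` F.

Local Notation T := (Operator D A).
Local Notation eigenproj w := (fun l => orth_proj ip (op_ker T l) w).

Let FB x y : F x -> F y -> F (x - y).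
Proof. exact: linear_subspaceB. Qed.

Let AB x y : F x -> F y -> A (x - y) = A x - A y.
Proof.
by move=> Fx Fy; rewrite addrC -scaleN1r A_linear// scaleN1r addrC.
Qed.

(* [orth_proj] is 0 when the projection does not exist, so no completeness is
   needed here. *)
Lemma eigenprojP w l (p := eigenproj w l) :
  [/\ F p, A p = l *: p, ip w p = ip p p & ip p w = ip p p].
Proof.
have [F0 _] := F_subspace.
suff [Fp Ap wp] : [/\ F p, A p = l *: p & ip w p = ip p p].
  by split=> //; rewrite ip_conj wp -ip_conj.
rewrite /p /orth_proj; case: xgetP => [q _ [[Dq Aq] /(_ q (conj Dq Aq))]|_].
  rewrite linearBl/= => /eqP; rewrite subr_eq0 => /eqP wq.
  by split=> //; exact: DF.
have A0 : A 0 = 0 by rewrite -(subrr 0) AB// !subrr.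
by split; rewrite ?A0 ?scaler0 ?linear0r.
Qed.

(** Indices range over all complex numbers; by symmetry a non-real one has projection zero and
    contributes nothing. *)
Lemma eigenproj_real w l : eigenproj w l = 0 \/ l^* = l.
Proof.
have [Fp Ap _ _] := eigenprojP w l; set p := orth_proj _ _ _ in Fp Ap *.
have [->|p0] := eqVneq p 0; [by left|right].
have := A_sym Fp Fp; rewrite Ap ipZl ipZr => /eqP.
by rewrite -subr_eq0 -mulrBl mulf_eq0 dnorm_eq0 (negPf p0) orbF subr_eq0 =>
  /eqP/esym.
Qed.

Lemma eigenproj_orth w l k : l != k -> ip (eigenproj w l) (eigenproj w k) = 0.
Proof.
move=> lk; have [Fl Al _ _] := eigenprojP w l.
have [Fk Ak _ _] := eigenprojP w k.
have [->|rk] := eigenproj_real w k; first by rewrite linear0r.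
have := A_sym Fl Fk; rewrite Al Ak ipZl ipZr rk => /eqP.
by rewrite -subr_eq0 -mulrBl mulf_eq0 subr_eq0 (negPf lk) => /eqP.
Qed.

Lemma sum_eigenproj_le w (r : seq R[i]) : uniq r ->
  \sum_(l <- r) `|eigenproj w l| ^+ 2 <= `|w| ^+ 2.
Proof.
move=> ur; under eq_bigr do rewrite -ip_norm.
rewrite -ip_norm.
apply: (@bessel_inequality _ _ _ setT (fun x y => ip x y) (eigenproj w)) => //.
- by move=> x y z _ _ _; rewrite linearBl.
- by move=> x y z _ _ _; rewrite linearBr.
- exact: eigenproj_orth.
- by move=> l; case: (eigenprojP w l).
- by move=> l; case: (eigenprojP w l).
Qed.

(** Bessel's inequality for [A w] and the orthogonal vectors [A p = l *: p]. *)
Lemma sum_sqr_eigenproj_le w (r : seq R[i]) : F w -> uniq r ->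
  \sum_(l <- r) `|l| ^+ 2 * `|eigenproj w l| ^+ 2 <= `|A w| ^+ 2.
Proof.
move=> Fw ur; pose p l := A (eigenproj w l).
have -> : \sum_(l <- r) `|l| ^+ 2 * `|eigenproj w l| ^+ 2 =
          \sum_(l <- r) ip (p l) (p l).
  apply: eq_bigr => l _; rewrite /p; have [_ -> _ _] := eigenprojP w l.
  by rewrite dnormZ ip_norm.
have Awp l : ip (A w) (p l) = ip (p l) (p l).
  rewrite /p; have [Fp Ap wp _] := eigenprojP w l.
  have [p0|rl] := eigenproj_real w l.
    by rewrite Ap p0 scaler0 !linear0r.
  by rewrite Ap ipZr A_sym// Ap ipZl !ipZr wp rl.
rewrite -ip_norm.
apply: (@bessel_inequality _ _ _ setT (fun x y => ip x y) p) => //.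
- by move=> x y z _ _ _; rewrite linearBl.
- by move=> x y z _ _ _; rewrite linearBr.
- move=> l k lk; rewrite /p.
  have [_ -> _ _] := eigenprojP w l; have [_ -> _ _] := eigenprojP w k.
  by rewrite ipZl ipZr eigenproj_orth// !mulr0.
- by move=> l; rewrite ip_conj Awp -ip_conj.
Qed.

(** Bessel's inequality for the form [(A x, y) - m (x, y)], nonnegative on [F]: eigenvectors for
    distinct eigenvalues are orthogonal for it too. *)
Lemma sum_form_eigenproj_le w (r : seq R[i]) : F w -> uniq r ->
  \sum_(l <- r) (l - m%:C) * `|eigenproj w l| ^+ 2 <=
  ip (A w) w - m%:C * `|w| ^+ 2.
Proof.
move=> Fw ur; pose B x y := ip (A x) y - m%:C * ip x y.
pose p := eigenproj w.
have BE l : (l - m%:C) * `|eigenproj w l| ^+ 2 = B (p l) (p l).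
  rewrite /B /p; have [_ -> _ _] := eigenprojP w l.
  by rewrite ipZl -mulrBl ip_norm.
under eq_bigr do rewrite BE.
have -> : ip (A w) w - m%:C * `|w| ^+ 2 = B w w by rewrite /B ip_norm.
have pw l : B (p l) w = B (p l) (p l).
  rewrite /B /p; have [Fp Ap _ pw] := eigenprojP w l.
  by rewrite Ap !ipZl pw.
apply: (@bessel_inequality _ _ _ F B p) => //.
- by move=> x y z Fx Fy Fz; rewrite /B AB// !linearBl/=; ring.
- by move=> x y z Fx Fy Fz; rewrite /B !linearBr/=; ring.
- by move=> x Fx; rewrite /B subr_ge0 ip_norm A_ge.
- by move=> l; case: (eigenprojP w l).
- move=> l k lk; rewrite /B /p.
  have [_ -> _ _] := eigenprojP w l.
  by rewrite ipZl eigenproj_orth// !mulr0 subrr.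
- move=> l; have [Fp Ap wp _] := eigenprojP w l.
  rewrite /B A_sym// wp [in RHS]A_sym// Ap !ipZr.
  by rewrite wp.
Qed.

(** The weight of order 1/2 is [1 + |l|], and [m <= l] at an eigenvalue gives
    [1 + |l| <= (l - m) + (1 + |m|)]. The bound involves the form at [w] but not [|A w|], so
    approximation in the form controls it. *)
Lemma sobolev_half_le w : F w ->
  (sobolev_sqnorm ip T (1 / 2) w <=
   (complex.Re (ip (A w) w - m%:C * `|w| ^+ 2 +
                (1 + `|m%:C|) * `|w| ^+ 2))%:E)%E.
Proof.
move=> Fw; apply: sobolev_sqnorm_le => r ur.
apply: (le_trans _ (lerD (sum_form_eigenproj_le Fw ur)
  (ler_wpM2l _ (sum_eigenproj_le w ur)))); last by rewrite addr_ge0.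
rewrite mulr_sumr -big_split/=; apply: ler_sum => l _.
have -> : 2 * (1 / 2) = 1 :> R by rewrite mul1r divff.
rewrite powRr1 ?addr_ge0 ?rnorm_ge0// rmorphD rmorph1/= rnormE -mulrDl.
have [Fp Ap _ _] := eigenprojP w l.
have [->|rl] := eigenproj_real w l; first by rewrite normr0 expr0n !mulr0.
set p := orth_proj _ _ _ in Fp Ap *.
have [->|p0] := eqVneq p 0; first by rewrite normr0 expr0n !mulr0.
have pp : 0 < `|p| ^+ 2 by rewrite exprn_gt0// normr_gt0.
rewrite ler_pM2r// addrCA lerD2l.
have : m%:C <= l by have := A_ge Fp; rewrite Ap ipZl ip_norm ler_pM2r.
rewrite -subr_ge0 => /ger0_norm {1}<-.
by rewrite -{1}[l](subrK m%:C) ler_normD.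
Qed.

(** Uses [(1 + |l|)^2 <= 2 (1 + |l|^2)]. It serves to place [F] inside the space of order 1. *)
Lemma sobolev_one_le w : F w ->
  (sobolev_sqnorm ip T 1 w <=
   (complex.Re ((`|w| ^+ 2 + `|A w| ^+ 2) *+ 2))%:E)%E.
Proof.
move=> Fw; apply: sobolev_sqnorm_le => r ur.
apply: (le_trans _ (ler_wMn2r 2 (lerD (sum_eigenproj_le w ur)
  (sum_sqr_eigenproj_le Fw ur)))).
rewrite -big_split/= -sumrMnl; apply: ler_sum => l _.
rewrite mulr1 powR_mulrn ?addr_ge0 ?rnorm_ge0//.
rewrite rmorphXn rmorphD rmorph1/= rnormE.
set P := `|_| ^+ 2.
have -> : (P + `|l| ^+ 2 * P) *+ 2 = (1 + `|l| ^+ 2) *+ 2 * P by ring.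
rewrite ler_wpM2r ?exprn_ge0//.
rewrite -subr_ge0.
have -> : (1 + `|l| ^+ 2) *+ 2 - (1 + `|l|) ^+ 2 = (1 - `|l|) ^+ 2 by ring.
by rewrite real_exprn_even_ge0// rpredB// normr_real.
Qed.

End SobolevBounds.

(** * The adjoint of a densely defined operator *)

Section Adjoint.
Context (R : realType) (H : completeNormedModType R[i]) (ip : inner_product H).
Hypothesis ip_norm : forall u : H, ip u u = `|u| ^+ 2.
Variable T : operator H.
Hypothesis T_dense : dense (opdom T).

Lemma adjointP u v : opdom T u -> Dmax ip T v ->
  ip (T u) v = ip u (adjoint ip T v).
Proof.
move=> Tu [w Hw].
exact: (xgetPex 0 (P := [set w | forall u, opdom T u -> ip (T u) v = ip u w])
  (ex_intro _ w Hw)).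
Qed.

(** Two candidates differ by a vector orthogonal to the dense set [opdom T]. *)
Lemma adjoint_unique v w : (forall u, opdom T u -> ip (T u) v = ip u w) ->
  Dmax ip T v /\ adjoint ip T v = w.
Proof.
move=> Hw; have Dv : Dmax ip T v by exists w.
split=> //; apply/eqP; rewrite -subr_eq0; apply/eqP.
apply: (dense_orth_eq0 ip_norm T_dense) => u Tu.
by rewrite linearBr/= -adjointP// Hw// subrr.
Qed.

Lemma adjoint_comb (a : R[i]) u v : Dmax ip T u -> Dmax ip T v ->
  Dmax ip T (a *: u + v) /\
  adjoint ip T (a *: u + v) = a *: adjoint ip T u + adjoint ip T v.
Proof.
move=> Du Dv; apply: adjoint_unique => x Tx.
by rewrite !linearDr/= !ipZr !adjointP.
Qed.

Lemma Dmax_subspace : linear_subspace (Dmax ip T).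
Proof.
split=> [|a u v Du Dv]; last by have [] := adjoint_comb a Du Dv.
by have [] := @adjoint_unique 0 0 (fun u _ => etrans (linear0r _ _)
  (esym (linear0r _ _))).
Qed.

Lemma adjoint_symmetric u : symmetric_operator ip T -> opdom T u ->
  Dmax ip T u /\ adjoint ip T u = T u.
Proof. by move=> symT Tu; apply: adjoint_unique => v Tv; exact: symT. Qed.

End Adjoint.

(** * The shifted form and the Friedrichs domain *)

Section FriedrichsForm.
Context (R : realType) (H : completeNormedModType R[i]) (ip : inner_product H).
Hypothesis ip_norm : forall u : H, ip u u = `|u| ^+ 2.
Variables (T : operator H) (m : R).
Hypothesis T_linear : linear_operator T.
Hypothesis T_dense : dense (opdom T).
Hypothesis T_symmetric : symmetric_operator ip T.
Hypothesis T_ge : forall u, opdom T u -> m%:C * `|u| ^+ 2 <= ip (T u) u.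

Local Notation A := (adjoint ip T).

(** Subtracting the lower bound [m] makes the form nonnegative on [opdom T]. *)
Definition shifted_adjoint (x : H) : H := A x - m%:C *: x.

Local Notation S := shifted_adjoint.

Definition friedrichs_dom : set H :=
  form_closure ip (opdom T) (Dmax ip T) S.

Let conj_real_complex (x : R) : (x%:C)^* = x%:C.
Proof. by apply/CrealP; rewrite complex_real. Qed.

Lemma shifted_adjoint_form x y : ip (S x) y = ip (A x) y - m%:C * ip x y.
Proof. by rewrite linearBl/= ipZl. Qed.

Lemma opdom_sub_Dmax : opdom T `<=` Dmax ip T.
Proof. by move=> u /(adjoint_symmetric ip_norm T_dense T_symmetric)[]. Qed.

Lemma shifted_adjoint_linear (a : R[i]) x y : Dmax ip T x -> Dmax ip T y ->
  S (a *: x + y) = a *: S x + S y.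
Proof.
move=> Dx Dy; rewrite /S; have [_ ->] := adjoint_comb ip_norm T_dense a Dx Dy.
rewrite scalerDr opprD addrACA; congr (_ + _).
by rewrite scalerBr !scalerA mulrC.
Qed.

Lemma shifted_adjoint_adjoint x y : opdom T x -> Dmax ip T y ->
  ip (S x) y = ip x (S y).
Proof.
move=> Tx Dy; rewrite /S.
have [_ ->] := adjoint_symmetric ip_norm T_dense T_symmetric Tx.
by rewrite linearBl linearBr/= ipZl ipZr adjointP// conj_real_complex.
Qed.

Lemma shifted_adjoint_ge0 x : opdom T x -> 0 <= ip (S x) x.
Proof.
move=> Tx; rewrite shifted_adjoint_form.
have [_ ->] := adjoint_symmetric ip_norm T_dense T_symmetric Tx.
by rewrite subr_ge0 ip_norm T_ge.
Qed.

Lemma friedrichs_dom_subspace : linear_subspace friedrichs_dom.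
Proof.
apply: form_closure_subspace T_linear.1 (Dmax_subspace ip_norm T_dense)
  opdom_sub_Dmax shifted_adjoint_linear shifted_adjoint_ge0.
Qed.

Lemma friedrichs_dom_sym x y : friedrichs_dom x -> friedrichs_dom y ->
  ip (A x) y = ip x (A y).
Proof.
move=> Fx Fy.
have := form_closure_sym ip_norm T_linear.1 (Dmax_subspace ip_norm T_dense)
  opdom_sub_Dmax shifted_adjoint_linear shifted_adjoint_adjoint
  shifted_adjoint_ge0 Fx Fy.
by rewrite linearBl linearBr/= ipZl ipZr conj_real_complex => /addIr.
Qed.

Lemma friedrichs_dom_ge x : friedrichs_dom x ->
  m%:C * `|x| ^+ 2 <= ip (A x) x.
Proof.
move=> Fx.
have := form_closure_ge0 ip_norm T_linear.1 (Dmax_subspace ip_norm T_dense)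
  opdom_sub_Dmax shifted_adjoint_linear shifted_adjoint_adjoint
  shifted_adjoint_ge0 Fx.
by rewrite shifted_adjoint_form subr_ge0 ip_norm.
Qed.

(** A sequence converging in [H] is Cauchy there, so the extra term [m |u_ n - u_ k|^2] of the
    shifted form tends to 0. *)
Lemma opdom_friedrichs_sub : opdom (friedrichs ip T) `<=` friedrichs_dom.
Proof.
move=> x [Dx [u_ Tu [ux uC]]]; split=> //; exists u_; split=> // eps eps0.
have [N HN] := uC _ (divr_gt0 eps0 (ltr0n _ 2)).
have m0 : 0 < `|m%:C| + 1 by rewrite ltr_wpDl.
(* Solves [(|m| + 1) d^2 = eps / 2]; both terms are then taken within [d / 2] of [x]. *)
pose d := sqrtC (eps / 2 / (`|m%:C| + 1)).
have d0 : 0 < d by rewrite sqrtC_gt0 !divr_gt0.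
have [M _ HM] := (cvgrPdist_lt _ _).1 ux _ (divr_gt0 d0 (ltr0n _ 2)).
exists (maxn N M) => n k; rewrite !geq_max => /andP[Nn Mn] /andP[Nk Mk].
have Tnk : opdom T (u_ n - u_ k)
  by exact: linear_subspaceB T_linear.1 (Tu n) (Tu k).
have S0 := shifted_adjoint_ge0 Tnk.
rewrite -(ger0_norm S0) shifted_adjoint_form.
have [_ ->] := adjoint_symmetric ip_norm T_dense T_symmetric Tnk.
apply: (le_lt_trans (ler_normB _ _)); rewrite [ltRHS]splitr ltr_leD//.
  exact: HN.
rewrite normrM ip_norm normrX normr_id.
have nk : `|u_ n - u_ k| <= d.
  rewrite -(subrKA x) (le_trans (ler_normD _ _))// [leRHS]splitr lerD//.
    by rewrite distrC; exact/ltW/HM.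
  exact/ltW/HM.
have : `|u_ n - u_ k| ^+ 2 <= eps / 2 / (`|m%:C| + 1).
  by rewrite -[leRHS]sqrtCK ler_sqr// nnegrE// ltW.
rewrite ler_pdivlMr// => /(le_trans _); apply.
by rewrite mulrC ler_wpM2l ?exprn_ge0// lerDl.
Qed.

Lemma opdom_sub_friedrichs_dom : opdom T `<=` friedrichs_dom.
Proof. by apply: sub_form_closure; exact: opdom_sub_Dmax. Qed.

(** The quantity made small is the bound of [sobolev_half_le] at [u - x], so [opdom T] is dense in
    [friedrichs_dom] for the norm of order 1/2. *)
Lemma friedrichs_dom_approx x (e : R[i]) : friedrichs_dom x -> 0 < e ->
  exists2 u, opdom T u &
    ip (S (u - x)) (u - x) + (1 + `|m%:C|) * `|u - x| ^+ 2 < e.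
Proof.
move=> Fx e0.
have m0 : 0 < 1 + `|m%:C| by rewrite ltr_wpDr.
pose d := sqrtC (e / 2 / (1 + `|m%:C|)).
have d0 : 0 < d by rewrite sqrtC_gt0 !divr_gt0.
(* A quarter rather than a half: the approximation gives only a weak inequality, and [e / 4 < e / 2]
   restores strictness. *)
have e4 : 0 < e / 4 by rewrite divr_gt0.
have [u Tu [xu Exu]] := form_closure_dense ip_norm T_linear.1
  (Dmax_subspace ip_norm T_dense) opdom_sub_Dmax shifted_adjoint_linear
  shifted_adjoint_adjoint shifted_adjoint_ge0 Fx d0 e4.
exists u => //; rewrite distrC.
have Dx : Dmax ip T x by case: Fx.
have Du : Dmax ip T u by exact: opdom_sub_Dmax.
have SB v w : Dmax ip T v -> Dmax ip T w -> S (v - w) = S v - S w.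
  move=> Dv Dw; rewrite addrC -scaleN1r shifted_adjoint_linear//.
  by rewrite scaleN1r addrC.
have -> : ip (S (u - x)) (u - x) = ip (S (x - u)) (x - u).
  by rewrite -(opprB x) linearNr -linearNl opprB !SB// opprB.
rewrite [ltRHS]splitr ltr_leD//.
  have Fw : friedrichs_dom (x - u).
    exact: linear_subspaceB friedrichs_dom_subspace Fx
      (opdom_sub_friedrichs_dom Tu).
  have S0 : 0 <= ip (S (x - u)) (x - u).
    by rewrite shifted_adjoint_form subr_ge0 ip_norm friedrichs_dom_ge.
  move: Exu; rewrite ger0_norm// => /le_lt_trans; apply.
  by rewrite ltr_pM2l// ltf_pV2 ?posrE// ltr_nat.
rewrite mulrC -ler_pdivlMr// -[leRHS]sqrtCK ler_sqr ?nnegrE ?normr_ge0//.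
  exact: ltW.
exact: ltW.
Qed.

End FriedrichsForm.

(** * Vanishing of the functionals [delta] that extend to order 1/2 *)

Theorem proposition4p1 (R : realType) (H : completeNormedModType R[i])
    (ip : inner_product H)
    (ip_norm : forall u : H, ip u u = `|u| ^+ 2)
    (H_separable : separable H)
    (Ac : operator H)
    (Ac_linear : linear_operator Ac)
    (Ac_dense : dense (opdom Ac))
    (Ac_symmetric : symmetric_operator ip Ac)
    (Ac_bounded_below : bounded_below ip Ac)
    (Dmax_compact : compact_inclusion ip Ac)
    (Dmin_codim : exists2 n : nat, (0 < n)%N &
                    has_codim (Dmin ip Ac) (Dmax ip Ac) n)
    (DF : set H)
    (DF_subspace : linear_subspace DF)
    (DF_sub : DF `<=` Dmin_compl ip Ac)
    (DF_friedrichs : set_sum DF (Dmin ip Ac) = opdom (friedrichs ip Ac)) :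
  let D := set_sum DF (Dmin ip Ac) in
  let AD := op_restrict (adjoint ip Ac) D in
  delta_space ip Ac D (graph_perp ip Ac DF)
    `&` sobolev_dual_in ip AD (1 / 2) 1
  = [set (fun=> 0)].
Proof.
move=> D AD; have [m Ac_ge] := Ac_bounded_below.
(* All estimates take place on [F], a subspace containing both [D] and [opdom Ac], hence also the
   differences [v - x] below. *)
pose F := friedrichs_dom ip Ac m.
have DF' : D `<=` F.
  by rewrite /D DF_friedrichs; exact: opdom_friedrichs_sub.
have CF : opdom Ac `<=` F by exact: opdom_sub_friedrichs_dom.
have Fsub : linear_subspace F by exact: friedrichs_dom_subspace.
have Flin (a : R[i]) x y : F x -> F y ->
    adjoint ip Ac (a *: x + y) = a *: adjoint ip Ac x + adjoint ip Ac y.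
  by move=> [Dx _] [Dy _]; have [] := adjoint_comb ip_norm Ac_dense a Dx Dy.
have Fsym x y : F x -> F y -> ip (adjoint ip Ac x) y = ip x (adjoint ip Ac y).
  exact: friedrichs_dom_sym.
have Fge x : F x -> m%:C * `|x| ^+ 2 <= ip (adjoint ip Ac x) x.
  exact: friedrichs_dom_ge.
have half w (Fw : F w) :=
  sobolev_half_le ip_norm Fsub Flin Fsym Fge DF' Fw.
have half_fin w : F w -> sobolev ip AD (1 / 2) w.
  by move=> /half h; exact: le_lt_trans h (ltry _).
(* Membership in the spaces of order 1/2 and 1 ensures that [functional_on] returns the value of [f]
   and not the default 0. *)
have one_fin w : F w -> sobolev ip AD 1 w.
  move=> Fw; have h := sobolev_one_le ip_norm Fsub Flin Fsym DF' Fw.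
  exact: le_lt_trans h (ltry _).
apply/seteqP; split=> [_ [[u [[Du _] _] <-] [f [_ _ f_cont] fE]]|_ ->].
  have Eval x : delta ip Ac D u x = functional_on (sobolev ip AD 1) f x.
    by rewrite fE.
  have f0 x : opdom Ac x -> f x = 0.
    move=> Cx; have := Eval x.
    rewrite /delta /functional_on /patch (mem_set (one_fin _ (CF _ Cx))) => <-.
    (* For [x] outside [D] the patched value is 0 by default. *)
    case: ifP => // _.
    have [_ ->] := adjoint_symmetric ip_norm Ac_dense Ac_symmetric Cx.
    by rewrite adjointP// subrr.
  apply/funext => x.
  have [xD|xD] := pselect (D x); last first.
    by rewrite /delta /functional_on /patch memNset.
  have Fx := DF' _ xD.
  rewrite Eval /functional_on /patch (mem_set (one_fin _ Fx)).
  apply/eqP; rewrite -normr_le0 -rnormE -(rmorph0 (real_complex R)) lecR.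
  apply/ler_addgt0Pr => e e0; rewrite add0r.
  have [del del0 f_close] := f_cont x (half_fin _ Fx) e e0.
  (* Squared because [sobolev_norm] is the square root of the quantity estimated. *)
  have del2 : 0 < (del ^+ 2)%:C by rewrite ltcR exprn_gt0.
  have [v Cv v_close] := friedrichs_dom_approx ip_norm Ac_linear Ac_dense
    Ac_symmetric Ac_ge Fx del2.
  have Fv := CF _ Cv.
  have -> : rnorm (f x) = rnorm (f v - f x).
    by rewrite (f0 v Cv) sub0r /rnorm normrN.
  apply/ltW.
  apply: f_close; first exact: half_fin.
  move: v_close; rewrite shifted_adjoint_form ip_norm ltcE.
  move=> /andP[_] /= v_close.
  have Fvx : F (v - x) by exact: linear_subspaceB.
  have := half _ Fvx; rewrite /sobolev_norm -/AD.
  have sq_ge0 : (0 <= sobolev_sqnorm ip AD (1 / 2)%R (v - x)%R)%E.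
    apply: esum_ge0 => l _.
    by rewrite lee_fin mulr_ge0 ?powR_ge0 ?exprn_ge0 ?rnorm_ge0.
  (* The squared norm is nonnegative with a finite upper bound, so the infinite cases are excluded
     and [fine] loses nothing. *)
  move: sq_ge0; case: sobolev_sqnorm => [q| |]//=; rewrite !lee_fin => q0 q_le.
  rewrite -(ger0_norm (ltW del0)) -sqrtr_sqr ltr_sqrt ?exprn_gt0//.
  exact: le_lt_trans q_le v_close.
(* Converse inclusion: the zero functional is [delta] of the vector 0 and the restriction of the
   zero functional of order 1/2. *)
have D0 : Dmax ip Ac 0 by exact: (Dmax_subspace ip_norm Ac_dense).1.
have A0 : adjoint ip Ac 0 = 0.
  have [_] := adjoint_comb ip_norm Ac_dense (-1) D0 D0.
  by rewrite !scaleN1r addNr addNr.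
split.
  exists 0.
    by split=> [|v _]; [split=> // v _|]; rewrite /graph_ip A0 !linear0l addr0.
  apply/funext => x; rewrite /delta /functional_on /patch.
  by case: ifP => // _; rewrite A0 !linear0r subr0.
exists (fun=> 0); last first.
  by apply/funext => x; rewrite /functional_on /patch; case: ifP.
split=> [|a u v _ _|u _ e e0].
- by apply/funext => x; rewrite /functional_on /patch; case: ifP.
- by rewrite mulr0 addr0.
- by exists 1 => // v _ _; rewrite subrr /rnorm normr0.
Qed.
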